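(* For every $n\ge 1$, the linear extension diameter of the Boolean lattice $B_n$ is $\mathrm{led}(B_n)=2^{2n-2}-(n+1)\cdot 2^{n-2}$.
   Context: $B_n$ is the poset of all subsets of $[n]$ ordered by inclusion. The distance between two linear extensions of a finite poset $\mathcal{P}$ is the number of unordered pairs of elements of $\mathcal{P}$ appearing in different orders in them; the linear extension diameter $\mathrm{led}(\mathcal{P})$ is the maximum distance over all pairs of linear extensions of $\mathcal{P}$. *)

(* Defs.v *)
From HB Require Import structures.
From mathcomp Require Import all_boot all_order.

Set Implicit Arguments.
Unset Strict Implicit.
Unset Printing Implicit Defensive.

Import Order.Theory.

Section LinearExtensionDiameter.

Variables (d : Order.disp_t) (P : finPOrderType d).

Definition before (L : seq P) (x y : P) : bool := index x L < index y L.

(* A linear extension is given as a listing of all the elements of P, each    *)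
(* exactly once, that is compatible with the order of P.                      *)
Definition linear_extension (L : #|P|.-tuple P) : bool :=
  uniq L && [forall x : P, forall y : P, (x < y)%O ==> before L x y].

Definition reversed_pairs (L1 L2 : #|P|.-tuple P) : {set {set P}} :=
  [set [set p.1; p.2] | p : P * P & before L1 p.1 p.2 && before L2 p.2 p.1].

Definition distance (L1 L2 : #|P|.-tuple P) : nat := #|reversed_pairs L1 L2|.

Definition led : nat :=
  \max_(L : #|P|.-tuple P * #|P|.-tuple P
          | linear_extension L.1 && linear_extension L.2) distance L.1 L.2.

End LinearExtensionDiameter.

Arguments led {d} P.

(* The order of {set 'I_n} provided by DefaultSetSubsetOrder is inclusion.    *)
Import Order.DefaultSetSubsetOrder.

Definition boolean_lattice (n : nat) : finPOrderType _ := {set 'I_n}.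

Lemma le_boolean_lattice (n : nat) (A B : boolean_lattice n) :
  (A <= B)%O = (A \subset B).
Proof. by []. Qed.

(* Main.v *)
(* Upper bound.  Group the pairs {A, B} by D = A symdiff B and C = A :&: B, so *)
(* that A = C :|: X and B = C :|: (D :\: X) with X a subset of D.  For a linear *)
(* extension L, the sets X such that A precedes B in L form a down-set of the  *)
(* subsets of D containing exactly one of X, D :\: X.  Two such down-sets are  *)
(* positively correlated (Harris-Kleitman), hence they share at least a        *)
(* quarter of the subsets of D, and at most half of the pairs of each group    *)
(* are reversed; none is when #|D| <= 1.                                       *)
(* Lower bound.  Reading sets as binary numbers, with the most significant bit *)
(* at either end, gives two linear extensions reversing exactly half of the    *)
(* pairs with a given D as soon as 1 < #|D|.                                   *)
Require Import Defs.
From HB Require Import structures.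
From mathcomp Require Import all_boot all_order all_algebra.
From mathcomp Require Import zify ring.

Set Implicit Arguments.
Unset Strict Implicit.
Unset Printing Implicit Defensive.

Import Order.Theory GRing.Theory Num.Theory.

(** Counting ordered pairs (A, B) with A first in one extension and B first in the other counts each
    reversed pair once ([distanceE]), and for fixed A the map from B to D = A symdiff B is a
    bijection. Each D with at least two elements contributes at most 2^n / 4 by the correlation
    inequality [sum_antitone_mul_le], smaller D contribute nothing, and [sum_card_gt1] counts 2^n -
    n - 1 relevant D. Two opposite binary orders attain 2^n / 4 for all these D at once, by
    [disagreements_ge] and [binary_rank_ltn]. Identities are kept free of subtraction and division
    until the last theorem. *)

Section SetSums.

Variable T : finType.
Implicit Types (A B C D X Y : {set T}) (f g h : {set T} -> nat).

(** * Sums over the subsets of a finite set, and the correlation inequality *)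

Definition symdiff A B : {set T} := (A :\: B) :|: (B :\: A).

Lemma in_symdiff A B x : (x \in symdiff A B) = ((x \in A) != (x \in B)).
Proof. by rewrite !inE; case: (x \in A); case: (x \in B). Qed.

Lemma symdiffK A : involutive (symdiff A).
Proof.
by move=> B; apply/setP => x; rewrite !in_symdiff; do 2 case: (_ \in _).
Qed.

Lemma sum_powersetU1 h x D : x \notin D ->
  \sum_(X : {set T} | X \subset x |: D) h X =
  \sum_(X : {set T} | X \subset D) (h X + h (x |: X)).
Proof.
move=> xD; rewrite big_split (bigID (fun X => x \notin X)) /=; congr (_ + _).
  apply: eq_bigl => X; apply/andP/idP => [[/subsetP XD xX]|XD].
    by apply/subsetP => y yX; move: (XD _ yX) xX; rewrite !inE => /predU1P[<-|//];
      rewrite yX.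
  by rewrite (subset_trans XD (subsetUr _ _)) (contra (subsetP XD x)).
rewrite (reindex_onto (fun X => x |: X) (fun X => X :\ x)) /=; last first.
  by move=> X /andP[_]; rewrite negbK => xX; rewrite setD1K.
apply: eq_bigl => X; rewrite setU11 andbT.
apply/andP/idP => [[XD /eqP <-]|XD].
  by rewrite subDset.
rewrite setUS ?setU1K ?eqxx //; exact: contra (subsetP XD x) xD.
Qed.

Lemma sum_powerset0 h : \sum_(X : {set T} | X \subset set0) h X = h set0.
Proof. by rewrite (eq_bigl (pred1 set0)) ?big_pred1_eq // => X; rewrite subset0. Qed.

Lemma powerset_ind (P : {set T} -> Prop) : P set0 ->
  (forall x D, x \notin D -> P D -> P (x |: D)) -> forall D, P D.
Proof.
move=> P0 PU D; have [m] := ubnP #|D|; elim: m D => // m IH D.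
have [->//|[x xD]] := set_0Vmem D.
rewrite (cardsD1 x) xD add1n ltnS => Dm.
by rewrite -(setD1K xD); apply: PU; [rewrite !inE eqxx | apply: IH].
Qed.

Definition antitone f := forall X Y, X \subset Y -> f Y <= f X.

(** Harris-Kleitman inequality without denominators, by induction on D, splitting the subsets
    according to whether they contain x. *)
Lemma sum_antitone_mul_le f g D :
    antitone f -> antitone g ->
  (\sum_(X : {set T} | X \subset D) f X) * (\sum_(X : {set T} | X \subset D) g X) <=
  2 ^ #|D| * \sum_(X : {set T} | X \subset D) f X * g X.
Proof.
elim/powerset_ind: D f g => [|x D xD IH] f g fm gm.
  by rewrite !sum_powerset0 cards0 mul1n.
rewrite !sum_powersetU1 // cardsU1 xD expnS !big_split /=.
have um h : antitone h -> antitone (fun X => h (x |: X)).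
  by move=> hm X Y XY; apply/hm/setUS.
have le1 h : antitone h ->
    \sum_(X : {set T} | X \subset D) h (x |: X) <= \sum_(X : {set T} | X \subset D) h X.
  by move=> hm; apply: leq_sum => X _; apply/hm/subsetUr.
have := IH _ _ fm gm; have := IH _ _ (um _ fm) (um _ gm).
have := le1 _ fm; have := le1 _ gm; move: (2 ^ _) => p.
(* With F0 >= F1 and G0 >= G1 the sums over subsets without and with x, the point is that 2(F0 G0 +
   F1 G1) - (F0 + F1)(G0 + G1) = (F0 - F1)(G0 - G1) >= 0. *)
by do 6 move: (\sum_(_ | _) _) => ?; nia.
Qed.

Lemma sum_setID h D :
  \sum_(A : {set T}) h A =
  \sum_(C : {set T} | C \subset ~: D) \sum_(X : {set T} | X \subset D) h (C :|: X).
Proof.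
rewrite pair_big_dep /=.
rewrite (reindex_onto (fun p => p.1 :|: p.2) (fun A => (A :\: D, A :&: D))) /=;
  last by move=> A _; rewrite setUC setID.
apply: eq_bigl => -[C X] /=; apply/eqP/andP => [[<- <-]|[]].
  by rewrite subsetIr setDE subsetIr.
move=> /subsetP CD /subsetP XD; congr (_, _); apply/setP => x; rewrite !inE;
  move: (CD x) (XD x); rewrite !inE;
  by case: (x \in C); case: (x \in X); case: (x \in D) => //= H1 H2;
     first [by have := H1 isT | by have := H2 isT].
Qed.

Lemma sum_powerset_compl h D :
  \sum_(X : {set T} | X \subset D) h (D :\: X) = \sum_(X : {set T} | X \subset D) h X.
Proof.
rewrite [RHS](reindex_onto (setD D) (setD D)) /= => [|X XD].
  apply: eq_bigl => X; rewrite subsetDl setDDr setDv set0U /=.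
  by apply/idP/eqP => [/setIidPr|<-]; rewrite ?subsetIl.
by rewrite setDDr setDv set0U; apply/setIidPr.
Qed.

Lemma sum_powerset1 D : \sum_(X : {set T} | X \subset D) 1 = 2 ^ #|D|.
Proof.
by rewrite sum1_card -card_powerset; apply: eq_card => X; rewrite powersetE.
Qed.

End SetSums.

(** * Pairs with fixed difference D and fixed intersection C, for one order *)

Section Fiber.

Variables (T : finType) (r : {set T} -> nat).
Hypotheses (r_inj : injective r).
Hypotheses (r_mono : forall A B : {set T}, A \proper B -> r A < r B).
Implicit Types (A B C D X Y : {set T}).

Definition fiber_lt C D X : nat := r (C :|: X) < r (C :|: (D :\: X)).

Lemma rank_sub A B : A \subset B -> r A <= r B.
Proof. by rewrite subEproper => /predU1P[->//|/r_mono/ltnW]. Qed.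

(** Enlarging X moves C :|: X later and C :|: (D :\: X) earlier. *)
Lemma fiber_lt_antitone C D : antitone (fiber_lt C D).
Proof.
move=> X Y XY; rewrite /fiber_lt.
have := rank_sub (setUS C XY); have := rank_sub (setUS C (setDS D XY)).
by move=> *; lia.
Qed.

(** Complementing X in D swaps the two sets, which differ since D is nonempty and disjoint from C;
    exactly one of them comes first. *)
Lemma fiber_lt_compl C D X : C \subset ~: D -> X \subset D -> D != set0 ->
  fiber_lt C D X + fiber_lt C D (D :\: X) = 1.
Proof.
move=> CD XD /set0Pn[x xD]; rewrite /fiber_lt setDDr setDv set0U (setIidPr XD).
suff: r (C :|: X) != r (C :|: (D :\: X)) by lia.
rewrite (inj_eq r_inj); apply/eqP => /setP/(_ x); rewrite !inE xD andbT.
have: x \notin C by apply/negP => /(subsetP CD); rewrite inE xD.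
by move/negPf->; case: (x \in X).
Qed.

Lemma sum_fiber_lt C D : C \subset ~: D -> D != set0 ->
  2 * \sum_(X : {set T} | X \subset D) fiber_lt C D X = 2 ^ #|D|.
Proof.
move=> CD D0; rewrite mul2n -addnn -{2}sum_powerset_compl -big_split /=.
by rewrite -sum_powerset1; apply: eq_bigr => X XD; apply: fiber_lt_compl.
Qed.

End Fiber.

(** * Counting the pairs on which two orders disagree *)

Section Disagreements.

Variable T : finType.
Implicit Types (A B C D X Y : {set T}) (r : {set T} -> nat).

Definition disagreements r1 r2 : nat :=
  \sum_(A : {set T}) \sum_(B : {set T}) (r1 A < r1 B) && (r2 B < r2 A).

Lemma disagreements_symdiff r1 r2 : disagreements r1 r2 =
  \sum_(D : {set T}) \sum_(A : {set T})
     (r1 A < r1 (symdiff A D)) && (r2 (symdiff A D) < r2 A).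
Proof.
rewrite exchange_big; apply: eq_bigr => A _.
by rewrite (reindex_inj (can_inj (symdiffK A))).
Qed.

(** The excluded sets are the empty set and the #|T| singletons. *)
Lemma sum_card_gt1 : \sum_(D : {set T}) (1 < #|D|) + #|T|.+1 = 2 ^ #|T|.
Proof.
have card_draws_eq k : \sum_(D : {set T}) (#|D| == k) = 'C(#|T|, k).
  by rewrite -big_mkcond /= sum1_card -card_draws; apply: eq_card => D; rewrite !inE.
have <- : \sum_(A : {set T}) 1 = 2 ^ #|T|.
  rewrite -cardsT -sum_powerset1; apply: eq_bigl => A; by rewrite subsetT.
have := card_draws_eq 0; have := card_draws_eq 1; rewrite bin0 bin1.
move=> E1 E0; rewrite -(addn1 #|T|) -E1 -[X in _ + (_ + X)]E0 -!big_split /=.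
by apply: eq_bigr => D _; lia.
Qed.

(** Toggling at most one element gives a comparable set, so such a D yields no reversed pair. *)
Lemma symdiff_small_comparable A D : #|D| <= 1 ->
  (symdiff A D == A) || (A \proper symdiff A D) || (symdiff A D \proper A).
Proof.
rewrite leq_eqVlt ltnS leqn0 cards_eq0 => /orP[/cards1P[x ->]|/eqP ->]; last first.
  by apply/orP; left; apply/orP; left; apply/eqP/setP => y; rewrite in_symdiff inE;
    case: (y \in A).
apply/orP; case xA: (x \in A); [right|left; apply/orP; right].
  have -> : symdiff A [set x] = A :\ x.
    by apply/setP => y; rewrite in_symdiff !inE; case: (y =P x) => [->|_]; rewrite ?xA;
      case: (y \in A).
  exact: properD1.
have -> : symdiff A [set x] = x |: A.
  by apply/setP => y; rewrite in_symdiff !inE; case: (y =P x) => [->|_]; rewrite ?xA;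
    case: (y \in A).
by apply: properUr; rewrite sub1set xA.
Qed.

Section UpperBound.

Variables r1 r2 : {set T} -> nat.
Hypotheses (r1_inj : injective r1) (r2_inj : injective r2).
Hypotheses (r1_mono : forall A B, A \proper B -> r1 A < r1 B).
Hypotheses (r2_mono : forall A B, A \proper B -> r2 A < r2 B).

(* With s1 = s2 = 2 ^ #|D| / 2 and s1 * s2 <= 2 ^ #|D| * c, the number c of    *)
(* common elements of both down-sets is at least 2 ^ #|D| / 4.                 *)
Lemma fiber_disagreements C D : C \subset ~: D -> D != set0 ->
  4 * \sum_(X : {set T} | X \subset D)
        ((r1 (C :|: X) < r1 (C :|: (D :\: X)))
         && (r2 (C :|: (D :\: X)) < r2 (C :|: X))) <= 2 ^ #|D|.
Proof.
move=> CD D0; set s := \sum_(_ | _) _.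
have := sum_fiber_lt r1_inj CD D0; have := sum_fiber_lt r2_inj CD D0.
have := sum_antitone_mul_le D (fiber_lt_antitone r1_mono C D)
  (fiber_lt_antitone r2_mono C D).
set s1 := \sum_(X : {set T} | X \subset D) fiber_lt r1 C D X.
set s2 := \sum_(X : {set T} | X \subset D) fiber_lt r2 C D X.
set c := \sum_(X : {set T} | X \subset D) _ * _.
(* Each X counted by s1 is either reversed by r2 (counted by s) or common to both down-sets (counted
   by c), never both. Hence s <= s1 - c <= 2^#|D| / 2 - 2^#|D| / 4. *)
have : s + c <= s1.
  rewrite -big_split /=; apply: leq_sum => X _; rewrite /fiber_lt.
  by case: (r1 _ < _) => //=; lia.
have : 0 < 2 ^ #|D| by rewrite expn_gt0.
by move: (2 ^ _) s s1 s2 c => p s s1 s2 c; nia.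
Qed.

(** For #|D| > 1, the sets A split into 2^(#|T| - #|D|) fibers, one for each C = A :\: D, and each
    fiber has at most 2^#|D| / 4 reversals. *)
Lemma symdiff_disagreements D :
  4 * \sum_(A : {set T}) (r1 A < r1 (symdiff A D)) && (r2 (symdiff A D) < r2 A)
    <= 2 ^ #|T| * (1 < #|D|).
Proof.
case: ltnP => [D1|D1]; last first.
  rewrite big1 ?muln0 // => A _.
  case/orP: (symdiff_small_comparable A D1) => [/orP[/eqP->|AD]|AD].
  - by rewrite ltnn.
  - by have := r2_mono AD; case: ltngtP; rewrite ?andbF.
  - by have := r1_mono AD; case: ltngtP; rewrite ?andbF.
have D0 : D != set0 by rewrite -card_gt0; lia.
rewrite (sum_setID _ D) muln1 big_distrr /= -(cardsC D) addnC expnD.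
rewrite -sum_powerset1 big_distrl /=; apply: leq_sum => C CD; rewrite mul1n.
apply: leq_trans (fiber_disagreements CD D0); rewrite leq_mul2l /=.
apply: leq_sum => X XD; suff -> : symdiff (C :|: X) D = C :|: (D :\: X) by [].
apply/setP => x; rewrite in_symdiff !inE.
move: (subsetP CD x) (subsetP XD x); rewrite !inE.
by case: (x \in C); case: (x \in X); case: (x \in D) => //= H1 H2;
     first [by have := H1 isT | by have := H2 isT].
Qed.

Lemma disagreements_le :
  4 * disagreements r1 r2 + 2 ^ #|T| * #|T|.+1 <= 2 ^ #|T| * 2 ^ #|T|.
Proof.
rewrite -{3}sum_card_gt1 mulnDr leq_add2r disagreements_symdiff !big_distrr /=.
by apply: leq_sum => D _; apply: symdiff_disagreements.
Qed.

End UpperBound.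

(** The memberships of x and y are independent, and each subset of the remaining elements extends in
    exactly one of four ways. *)
Lemma sum_mem_notin (x y : T) : x != y ->
  4 * \sum_(A : {set T}) (x \in A) && (y \notin A) = 2 ^ #|T|.
Proof.
move=> xy; pose E := ~: [set x; y].
have cE : #|T| = 2 + #|E| by rewrite -(cardsC [set x; y]) cards2 xy.
have TE : setT = x |: (y |: E) :> {set T}.
  by apply/setP => z; rewrite !inE; case: eqP => //; case: eqP.
have yE : y \notin E by rewrite !inE eqxx orbT.
have xE : x \notin y |: E by rewrite !inE eqxx (negPf xy).
rewrite (eq_bigl (fun A : {set T} => A \subset setT)) => [|A]; last by rewrite subsetT.
rewrite TE !sum_powersetU1 // cE expnD -sum_powerset1; congr (_ * _).
apply: eq_bigr => X XE; rewrite !inE !eqxx (negPf xy) (eq_sym y) (negPf xy) /=.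
have /negPf-> : x \notin X by apply: contra (subsetP XE x) _; rewrite !inE eqxx.
by have /negPf-> : y \notin X by apply: contra (subsetP XE y) _; rewrite !inE eqxx orbT.
Qed.

(** Criterion for optimality: for each D, the quarter of all sets A that contain one chosen point
    and avoid another is reversed with its partner. *)
Lemma disagreements_ge r1 r2 :
    (forall D, 1 < #|D| -> exists2 p : T * T, p.1 != p.2 &
      forall A, p.1 \in A -> p.2 \notin A ->
        r1 A < r1 (symdiff A D) /\ r2 (symdiff A D) < r2 A) ->
  2 ^ #|T| * 2 ^ #|T| <= 4 * disagreements r1 r2 + 2 ^ #|T| * #|T|.+1.
Proof.
move=> sep; rewrite -{2}sum_card_gt1 mulnDr leq_add2r disagreements_symdiff.
rewrite !big_distrr /=; apply: leq_sum => D _.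
case: ltnP => [/sep[[x y] /= xy xyP]|_]; last by rewrite muln0.
rewrite muln1 -(sum_mem_notin xy) leq_mul2l /=; apply: leq_sum => A _.
case: andP => // -[xA yA]; have [-> ->] := xyP A xA yA; by [].
Qed.

End Disagreements.

(** * Reading sets as binary numbers *)

Section BinaryRank.

Variables (T : finType) (w : T -> nat).
Hypothesis w_inj : injective w.
Implicit Types A B D : {set T}.

Definition binary_rank A : nat := \sum_(i in A) 2 ^ w i.

Lemma binary_rank_lt_exp A m : {in A, forall i, w i < m} -> binary_rank A < 2 ^ m.
Proof.
elim: m A => [|m IH] A Am.
  rewrite /binary_rank big1 // => i iA; by have := Am _ iA.
case: (pickP (fun i => (i \in A) && (w i == m))) => [i /andP[iA /eqP wi]|no].
  rewrite /binary_rank (big_setD1 i iA) /= expnS mul2n -addnn wi ltn_add2l.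
  apply: IH => j; rewrite !inE => /andP[ji jA].
  have := Am _ jA; rewrite ltnS leq_eqVlt => /predU1P[|//].
  by rewrite -wi => /w_inj jieq; rewrite jieq eqxx in ji.
apply: ltn_trans (IH A _) _; last by rewrite ltn_exp2l.
move=> j jA; have := Am _ jA; have := no j; rewrite jA /=; lia.
Qed.

(** The heaviest element on which A and B differ decides: after cancelling A :&: B, the single term
    2 ^ w i exceeds the whole rank of A :\: B, whose weights are distinct and below w i. *)
Lemma binary_rank_ltn A B i : i \in B -> i \notin A ->
  {in symdiff A B, forall j, w j <= w i} -> binary_rank A < binary_rank B.
Proof.
move=> iB iA top; rewrite /binary_rank (big_setID B) [ltnRHS](big_setID A) /=.
rewrite setIC ltn_add2l [ltnRHS](big_setD1 i) /=; last by rewrite inE iA.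
apply: leq_trans (leq_addr _ _); apply: binary_rank_lt_exp => j jAB.
have: w j <= w i by apply: top; rewrite inE jAB.
rewrite leq_eqVlt => /predU1P[/w_inj ji|//].
by move: jAB; rewrite ji inE iB.
Qed.

Lemma symdiff_neq0 A B : A != B -> exists i, i \in symdiff A B.
Proof.
move=> AB; apply/set0Pn; apply: contra AB => /eqP D0; apply/eqP/setP => x.
by move/setP/(_ x): D0; rewrite in_symdiff inE; do 2 case: (_ \in _).
Qed.

Lemma binary_rank_inj : injective binary_rank.
Proof.
move=> A B eqr; apply/eqP/negPn/negP => /symdiff_neq0[i0 i0D].
case: (arg_maxnP w i0D) => i /= iD top; have {}iD : i \in symdiff A B := iD.
move: (iD); rewrite in_symdiff; case iA: (i \in A); case iB: (i \in B) => // _.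
  suff: binary_rank B < binary_rank A by rewrite eqr ltnn.
  apply: (@binary_rank_ltn _ _ i); rewrite ?iB // => j jD; apply: top.
  by rewrite /symdiff setUC in jD.
suff: binary_rank A < binary_rank B by rewrite eqr ltnn.
by apply: (@binary_rank_ltn _ _ i); rewrite ?iA.
Qed.

Lemma binary_rank_proper A B : A \proper B -> binary_rank A < binary_rank B.
Proof.
move=> /properP[AB [i iB iA]].
rewrite /binary_rank [ltnRHS](big_setID A) /= (setIidPr AB).
rewrite -[ltnLHS]addn0 ltn_add2l (big_setD1 i) ?inE ?iA //=.
by rewrite addn_gt0 expn_gt0.
Qed.

End BinaryRank.

(** * Linear extensions and rank functions *)

Section LinearExtensions.

Variables (d : Order.disp_t) (P : finPOrderType d).
Implicit Types (L : #|P|.-tuple P) (r : P -> nat).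

Lemma distanceE L1 L2 :
  distance L1 L2 =
  \sum_(x : P) \sum_(y : P) (before L1 x y && before L2 y x).
Proof.
(* The map from (x, y) to {x, y} is injective here: [L1] cannot place x before y and also y before
   x. *)
rewrite /distance /reversed_pairs card_in_imset => [|[x y] [x' y']]; last first.
  rewrite !inE /before /= => /andP[xy1 _] /andP[xy2 _] /setP eqxy.
  have /set2P : x \in [set x'; y'] by rewrite -eqxy set21.
  have /set2P : y \in [set x'; y'] by rewrite -eqxy set22.
  by case=> ? [] ?; subst=> //; lia.
rewrite -sum1_card big_mkcond pair_big /=; apply: eq_bigr => -[x y] _.
by rewrite inE; case: (_ && _).
Qed.

Lemma mem_linear_extension L : uniq L -> forall x, x \in L.
Proof.
move=> uL x; have sub : {subset L <= enum P} by move=> y _; rewrite mem_enum.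
by rewrite (uniq_min_size uL sub) ?mem_enum // -cardE size_tuple.
Qed.

Lemma linear_extension_index_inj L :
  linear_extension L -> injective (fun x => index x L).
Proof.
by move=> /andP[/mem_linear_extension memL _] x y; apply: index_inj.
Qed.

Lemma linear_extension_index_lt L : linear_extension L ->
  forall x y : P, (x < y)%O -> index x L < index y L.
Proof. by move=> /andP[_ /forallP Llt] x y; apply/implyP/(forallP (Llt x)). Qed.

(** Sort all elements by r; injectivity excludes ties, so positions and ranks compare alike. *)
Lemma linear_extension_of_rank r : injective r ->
    (forall x y : P, (x < y)%O -> r x < r y) ->
  exists2 L, linear_extension L & forall x y, before L x y = (r x < r y).
Proof.
move=> r_inj r_mono; pose s := sort (relpre r leq) (enum P).
have szs : size s == #|P| by rewrite size_sort -cardE.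
have mems x : x \in s by rewrite mem_sort mem_enum.
have rtr : transitive (relpre r leq) by move=> ? ? ?; apply: leq_trans.
have rtot : total (relpre r leq) by move=> ? ?; apply: leq_total.
have bef x y : (index x s < index y s) = (r x < r y).
  have sl u v : index u s < index v s -> r u <= r v.
    exact: (sorted_ltn_index rtr (sort_sorted rtot _)).
  have := sl x y; have := sl y x.
  case: (ltngtP (index x s)) => [xy|xy|/index_inj -> //]; last by rewrite ltnn.
  - move=> _ /(_ isT); rewrite leq_eqVlt => /predU1P[/r_inj E|->//].
    by rewrite E ltnn in xy.
  - by move=> /(_ isT); case: ltngtP.
exists (Tuple szs) => [|x y]; last exact: bef.
apply/andP; split; first by rewrite /= sort_uniq enum_uniq.
apply/forallP => x; apply/forallP => y; apply/implyP => /r_mono.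
by rewrite -bef.
Qed.

End LinearExtensions.

(** * The diameter of the Boolean lattice *)

Lemma led_boolean_lattice n :
  4 * led (boolean_lattice n) + 2 ^ n * n.+1 = 2 ^ n * 2 ^ n.
Proof.
have nle : 2 ^ n * n.+1 <= 2 ^ n * 2 ^ n by rewrite leq_mul2l ltn_expl ?orbT.
apply/eqP; rewrite eqn_leq; apply/andP; split.
  (* A maximum is bounded term by term only against a bound on [led] itself, hence the passage to a
     quotient by 4. *)
  suff : led (boolean_lattice n) <= (2 ^ n * 2 ^ n - 2 ^ n * n.+1) %/ 4.
    by rewrite leq_divRL // mulnC leq_subRL // addnC.
  rewrite /led; apply/bigmax_leqP => -[L1 L2] /= /andP[H1 H2].
  rewrite leq_divRL // mulnC leq_subRL // addnC.
  have := @disagreements_le _ _ _ (linear_extension_index_inj H1)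
    (linear_extension_index_inj H2) (linear_extension_index_lt H1)
    (linear_extension_index_lt H2).
  by rewrite card_ord distanceE.
(* Opposite significance orders of the digits: [w1] makes the largest index most significant, [w2]
   the smallest. *)
pose w1 (i : 'I_n) : nat := i; pose w2 (i : 'I_n) : nat := n - i.
have w1_inj : injective w1 := @ord_inj n.
have w2_inj : injective w2.
  by move=> i j; rewrite /w2 => ij; apply: ord_inj;
    have := ltn_ord i; have := ltn_ord j; lia.
have [L1 H1 E1] := @linear_extension_of_rank _ (boolean_lattice n)
  (binary_rank w1) (binary_rank_inj w1_inj) (fun A B => @binary_rank_proper _ w1 A B).
have [L2 H2 E2] := @linear_extension_of_rank _ (boolean_lattice n)
  (binary_rank w2) (binary_rank_inj w2_inj) (fun A B => @binary_rank_proper _ w2 A B).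
have le_led : distance L1 L2 <= led (boolean_lattice n).
  by apply: (@leq_bigmax_cond _ _ (fun L => distance L.1 L.2) (L1, L2)); rewrite H1.
have eq_dist : distance L1 L2 = disagreements (binary_rank w1) (binary_rank w2).
  rewrite distanceE; apply: eq_bigr => A _; apply: eq_bigr => B _.
  by rewrite E1 E2.
rewrite eq_dist in le_led.
suff : 2 ^ #|'I_n| * 2 ^ #|'I_n| <=
    4 * disagreements (binary_rank w1) (binary_rank w2) + 2 ^ #|'I_n| * #|'I_n|.+1.
  by rewrite card_ord => ge; apply: leq_trans ge _; rewrite leq_add2r leq_mul2l.
apply: disagreements_ge => D D1.
have [i0 i0D] : exists i, i \in D by apply/set0Pn; rewrite -card_gt0; lia.
(* M is the largest element of D and m, maximizing [w2], the smallest; they differ because #|D| >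
   1. *)
case: (arg_maxnP w1 i0D) => M /= MD Mtop; case: (arg_maxnP w2 i0D) => m /= mD mtop.
have mM : m != M.
  apply/eqP => mM; move: D1; rewrite ltnNge => /negP; apply.
  rewrite -(cards1 m) subset_leq_card //; apply/subsetP => i iD; rewrite inE.
  apply/eqP/ord_inj; have := Mtop _ iD; have := mtop _ iD; rewrite /w1 /w2 mM.
  by have := ltn_ord i; have := ltn_ord M; lia.
(* If A contains m but not M, its partner A symdiff D contains M but not m. The first order, decided
   at M, puts the partner later; the second, decided at m, puts it earlier. *)
exists (m, M) => //= A mA MA; split.
  apply: (@binary_rank_ltn _ _ w1_inj _ _ M) => // [|j].
    by rewrite in_symdiff (negPf MA) [M \in D]MD.
  by rewrite symdiffK => /Mtop.
apply: (@binary_rank_ltn _ _ w2_inj _ _ m) => // [|j].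
  by rewrite in_symdiff mA [m \in D]mD.
by rewrite /symdiff setUC -/(symdiff _ _) symdiffK => /mtop.
Qed.

Local Open Scope ring_scope.

Theorem theorem1 (n : nat) (hn : (1 <= n)%N) :
  (led (boolean_lattice n))%:R
    = (2%:R : rat) ^ (2 * n%:Z - 2) - (n%:R + 1) * (2%:R : rat) ^ (n%:Z - 2).
Proof.
have /(congr1 (fun k => k%:R : rat)) := led_boolean_lattice n.
rewrite natrD !natrM !natrX -(natr1 n); move: (led _)%:R => l E.
have -> : 2 * n%:Z - 2 = n%:Z + n%:Z - 2 by ring.
(* Since 2 is nonzero in [rat], the factor 2 ^ (-2) splits off even when n - 2 is negative. *)
rewrite !expfzDr // -!exprnP -exprnN.
have -> : l = (4%:R * l) / 4%:R by field.
have -> : 4%:R * l = 2 ^+ n * 2 ^+ n - 2 ^+ n * (n%:R + 1) by rewrite -E addrK.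
by field.
Qed.
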